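(* Let $\underline r\in F((z^{-1}))^m$ with $v(\underline r)>0$ (a multi-sequence), let $C=[\underline a_0,h_1,\underline a_1,h_2,\underline a_2,\dots]\in\mathbf T(\underline r)$ have length $\omega$, with associated $q_k,d_k,n_k$. Put $n_0=1$, and $n_\omega=\infty$ in the case $\omega<\infty$. Then for every $0\le k<\omega$ and every integer $n$ with $n_k\le n<n_{k+1}$, $q_k(z)$ is a minimal polynomial of $\underline r^{(n)}$, and $L_n(\underline r)=d_k$.
   Context: Let $F$ be a field, $m\ge 1$ an integer, $Z_m=\{1,\dots,m\}$. $F((z^{-1}))$ is the field of formal Laurent series $\sum_{t\ge i}a_tz^{-t}$ ($i\in\mathbb Z$, $a_t\in F$), with valuation $v(\sum_{t\ge i}a_tz^{-t})=i$ if $a_i\ne 0$, and $v(0)=\infty$. Elements of $F((z^{-1}))^m$ are column vectors. For $\alpha\in F((z^{-1}))$, $\lfloor\alpha\rfloor\in F[z]$ is the polynomial part (terms $z^{i}$, $i\ge0$) and $\{\alpha\}=\alpha-\lfloor\alpha\rfloor$; both are extended componentwise to vectors. Order $Z_m\times\mathbb Z$ linearly by $(h,v)<(h',v')$ iff $v<v'$, or $v=v'$ and $h<h'$. For $\underline r=(r_1,\dots,r_m)^\tau\ne\underline 0$ put $v(\underline r)=\min_i v(r_i)$, $I(\underline r)=\min\{i: v(r_i)=v(\underline r)\}$ and $Iv(\underline r)=(I(\underline r),v(\underline r))$; $v(\underline 0)=\infty$, $Iv(\underline 0)=(1,\infty)$, which is larger than every element of $Z_m\times\mathbb Z$. Multi-sequences: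 $m$ sequences $r_j=\{c_{j,t}\}_{t\ge0}$ over $F$ are identified with $\underline r=(r_1(z),\dots,r_m(z))^\tau$, $r_j(z)=\sum_{t\ge0}c_{j,t}z^{-1-t}$, i.e. with an element of $F((z^{-1}))^m$ of valuation $>0$; $\underline r^{(n)}$ is the length-$n$ prefix. A nonzero polynomial $q\in F[z]$ is a characteristic polynomial of $\underline r^{(n)}$ if $Iv(\underline r-\lfloor\underline r q\rfloor/q)>(m,n)$; it is a minimal polynomial of $\underline r^{(n)}$ if it is a characteristic polynomial of $\underline r^{(n)}$ of smallest degree, and that degree is the linear complexity $L_n(\underline r)$. $m$-CF transform of $\underline r$ with $v(\underline r)>0$. Start with $\underline a_0=\underline 0$, $\Delta_{-1}=I_m$ (i.e. $c_{0,j}=0$ for all $j$), $\beta_0=\underline r$. Suppose for some $k\ge1$ that $\Delta_{k-2}=\mathrm{Diag}(z^{-c_{k-1,1}},\dots,z^{-c_{k-1,m}})$ and $\beta_{k-1}=(\beta_{k-1,1},\dots,\beta_{k-1,m})^\tau$ have been defined. If $\beta_{k-1}=\underline 0$, stop and put $\omega=k$. Otherwise: (i) $h_k=I(\Delta_{k-2}\beta_{k-1})$; (ii) $\Delta_{k-1}=\mathrm{Diag}(z^{-c_{k,1}},\dots,z^{-c_{k,m}})$ with $c_{k,j}=c_{k-1,j}$ for $j\ne h_k$ and $c_{k,h_k}=v(\Delta_{k-2}\beta_{k-1})$; (iii) let $\rho_k=(\rho_{k,1},\dots,\rho_{k,m})^\tau$ with $\rho_{k,j}=\beta_{k-1,j}/\beta_{k-1,h_k}$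 for $j\ne h_k$ and $\rho_{k,h_k}=1/\beta_{k-1,h_k}$; choose freely $\underline\epsilon_k\in F[z]^m$ subject to $Iv(\Delta_{k-1}\{\rho_k\})\le Iv(\Delta_{k-1}\underline\epsilon_k)$, and put $\underline a_k=\lfloor\rho_k\rfloor-\underline\epsilon_k$, $\beta_k=\{\rho_k\}+\underline\epsilon_k$. If the procedure never stops, $\omega=\infty$. The output is $C=[\underline 0,h_1,\underline a_1,h_2,\underline a_2,\dots]$ of length $\omega$ (indices $1\le k<\omega$). $\mathbf T(\underline r)$ is the set of all outputs over all admissible choices of the $\underline\epsilon_k$. Quantities associated with $C$: let $E_h$ be the matrix obtained from $I_{m+1}$ by exchanging columns $h$ and $m+1$, and $A(\underline a)=\begin{pmatrix} I_m&\underline a\\0&1\end{pmatrix}$. Put $B_0=I_{m+1}$, $B_k=B_{k-1}E_{h_k}A(\underline a_k)$ for $1\le k<\omega$; $q_k\in F[z]$ is the bottom right entry of $B_k$. With $a_{k,j}$ the $j$-th component of $\underline a_k$ (one has $\deg a_{k,h_k}\ge1$), $t_k=\deg a_{k,h_k}$, $v_{k}=\sum_{1\le i\le k,\,h_i=h_k}t_i$, $d_k=\sum_{1\le i\le k}t_i$ ($d_0=0$), $n_k=d_{k-1}+v_k$ for $1\le k<\omega$. *)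

(* Defs.v *)
From HB Require Import structures.
From mathcomp Require Import all_boot all_order all_algebra.
From mathcomp Require Import boolp classical_sets functions cardinality fsbigop.
From mathcomp Require Import constructive_ereal.
From mathcomp Require Import zify.

Set Implicit Arguments.
Unset Strict Implicit.
Unset Printing Implicit Defensive.

Import Order.TTheory GRing.Theory Num.Theory.

Local Open Scope classical_set_scope.
Local Open Scope ring_scope.

(** * The field F((z^-1)) of formal Laurent series in z^-1 *)

Section LaurentSeries.
Variable F : fieldType.

Definition vanish_below (M : int) (a : int -> F) : Prop :=
  forall t, t < M -> a t = 0.

Definition laurent_pred : pred (int -> F) :=
  fun a => `[< exists M, vanish_below M a >].

(* [a t] is the coefficient of z^(-t) in [a]. *)
Record laurent : Type :=
  Laurent { lcoef :> int -> F; lcoefP : lcoef \in laurent_pred }.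

HB.instance Definition _ := [isSub for lcoef].
HB.instance Definition _ := [Choice of laurent by <:].

Lemma laurent_zmod_closed : zmod_closed laurent_pred.
Proof.
split=> [|a b]; first by apply/asboolP; exists 0.
move=> /asboolP exM /asboolP exN; have [[M aM] [N bN]] := (exM, exN).
apply/asboolP; exists (Order.min M N) => t; rewrite lt_min => /andP[tM tN].
by change (a t - b t = 0); rewrite aM // bN // subrr.
Qed.
HB.instance Definition _ :=
  GRing.isZmodClosed.Build (int -> F) laurent_pred laurent_zmod_closed.
HB.instance Definition _ := [SubChoice_isSubZmodule of laurent by <:].

Lemma laurentP (a b : laurent) : a =1 b -> a = b.
Proof. by move=> ab; apply/val_inj/funext. Qed.

Lemma lcoef_bound (a : laurent) : exists M, vanish_below M a.
Proof. by apply/asboolP; exact: lcoefP. Qed.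

(* The sum has finitely many nonzero terms, see [cauchyE]. *)
Definition cauchy (a b : int -> F) (t : int) : F :=
  \sum_(i \in [set: int]) a i * b (t - i).

Lemma cauchyE M N K t a b : vanish_below M a -> vanish_below N b ->
  t < M + N + K%:Z ->
  cauchy a b t = \sum_(i < K) a (M + i%:Z) * b (t - (M + i%:Z)).
Proof.
move=> aM bN tK.
pose r := [seq M + i%:Z | i <- iota 0 K].
have ur : uniq r by rewrite map_inj_uniq ?iota_uniq// => i j /addrI [].
rewrite -(big_mkord xpredT (fun i : nat => a (M + i%:Z) * b (t - (M + i%:Z)))).
rewrite /index_iota subn0.
rewrite -(big_map (fun i : nat => M + i%:Z) xpredT (fun i => a i * b (t - i))).
rewrite (fsbig_seq _ _ ur) /cauchy.
apply: esym; apply: fsbig_widen => // i [_ /= ir].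
have [iM|Mi] := ltP i M; first by rewrite aM ?mul0r.
rewrite bN ?mulr0//.
have [iK|] := ltP i (M + K%:Z); last by lia.
exfalso; apply: ir; apply/mapP; exists `|(i - M)%R|%N; last by lia.
by rewrite mem_iota; lia.
Qed.

Lemma vanish_below_cauchy M N a b : vanish_below M a -> vanish_below N b ->
  vanish_below (M + N) (cauchy a b).
Proof. by move=> aM bN t tMN; rewrite (@cauchyE M N 0) ?addr0// big_ord0. Qed.

Lemma cauchy_laurent (a b : laurent) : cauchy a b \in laurent_pred.
Proof.
have [[M aM] [N bN]] := (lcoef_bound a, lcoef_bound b).
by apply/asboolP; exists (M + N); apply: vanish_below_cauchy.
Qed.

Definition lmul (a b : laurent) : laurent := Laurent (cauchy_laurent a b).

Definition trunc (M : int) (K : nat) (a : int -> F) : {poly F} :=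
  \poly_(i < K) a (M + i%:Z).

Lemma cauchy_trunc M N K n a b : vanish_below M a -> vanish_below N b ->
  (n < K)%N -> cauchy a b (M + N + n%:Z) = (trunc M K a * trunc N K b)`_n.
Proof.
move=> aM bN nK; rewrite (@cauchyE M N n.+1)//; last by lia.
rewrite coefM; apply: eq_bigr => i _; rewrite !coef_poly.
have iK : (i < K)%N by rewrite (leq_trans (ltn_ord i)).
rewrite iK (leq_ltn_trans (leq_subr _ _) nK).
by congr (_ * b _); have := ltn_ord i; lia.
Qed.

Lemma cauchy_trunc2 M N P n a b c :
  vanish_below M a -> vanish_below N b -> vanish_below P c ->
  cauchy (cauchy a b) c (M + N + P + n%:Z) =
  (trunc M n.+1 a * trunc N n.+1 b * trunc P n.+1 c)`_n.
Proof.
move=> aM bN cP; rewrite (@cauchy_trunc _ _ n.+1)//; last first.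
  exact: vanish_below_cauchy.
rewrite !coefM; apply: eq_bigr => i _; congr (_ * _).
by rewrite coef_poly ltn_ord (@cauchy_trunc _ _ n.+1).
Qed.

Lemma lmulC : commutative lmul.
Proof.
move=> a b; apply: laurentP => t /=.
have [[M aM] [N bN]] := (lcoef_bound a, lcoef_bound b).
have [tMN|MNt] := ltP t (M + N).
  by rewrite (vanish_below_cauchy aM bN)// (vanish_below_cauchy bN aM)// addrC.
have [n ->] : exists n : nat, t = M + N + n%:Z.
  by exists `|(t - (M + N))%R|%N; lia.
rewrite (@cauchy_trunc _ _ n.+1)// [M + N]addrC.
by rewrite (@cauchy_trunc _ _ n.+1)// mulrC.
Qed.

Lemma lmulA : associative lmul.
Proof.
move=> a b c; rewrite (lmulC a); apply: laurentP => t /=; apply: esym.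
have [[M aM] [N bN]] := (lcoef_bound a, lcoef_bound b).
have [P cP] := lcoef_bound c.
have v1 := vanish_below_cauchy (vanish_below_cauchy aM bN) cP.
have v2 := vanish_below_cauchy (vanish_below_cauchy bN cP) aM.
have e : N + P + M = M + N + P by lia.
have [tMN|MNt] := ltP t (M + N + P); first by rewrite v1// v2// e.
have [n ->] : exists n : nat, t = M + N + P + n%:Z.
  by exists `|(t - (M + N + P))%R|%N; lia.
rewrite -[in RHS]e (cauchy_trunc2 _ aM bN cP) (cauchy_trunc2 _ bN cP aM).
by rewrite -mulrA mulrC.
Qed.

Lemma vanish_belowS M N a : N <= M -> vanish_below M a -> vanish_below N a.
Proof. by move=> NM aM t tN; apply: aM; apply: lt_le_trans NM. Qed.

Lemma lmulDl : left_distributive lmul +%R.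
Proof.
move=> a b c; apply: laurentP => t /=.
have [[M aM] [N bN]] := (lcoef_bound a, lcoef_bound b).
have [P cP] := lcoef_bound c.
pose Q := Order.min M N.
have aQ : vanish_below Q a by apply: vanish_belowS aM; rewrite ge_min lexx.
have bQ : vanish_below Q b by apply: vanish_belowS bN; rewrite ge_min lexx orbT.
have abQ : vanish_below Q (lcoef (a + b)).
  by move=> s sQ; change (a s + b s = 0); rewrite aQ // bQ // addr0.
have tK : t < Q + P + `|(t - (Q + P))%R|.+1%:Z by lia.
change (cauchy (lcoef (a + b)) c t = cauchy a c t + cauchy b c t).
rewrite (cauchyE abQ cP tK).
rewrite [X in _ = X + _](cauchyE aQ cP tK) [X in _ = _ + X](cauchyE bQ cP tK).
by rewrite -big_split /=; apply: eq_bigr => i _; rewrite -mulrDl.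
Qed.

Lemma lone_subproof : (fun t : int => (t == 0)%:R : F) \in laurent_pred.
Proof. by apply/asboolP; exists 0 => t t0; rewrite lt_eqF. Qed.
Definition lone : laurent := Laurent lone_subproof.

Lemma lmul1 : left_id lone lmul.
Proof.
move=> a; apply: laurentP => t /=.
have [M aM] := lcoef_bound a.
have v1 : vanish_below 0 lone by move=> s s0 /=; rewrite lt_eqF.
rewrite (@cauchyE 0 M `|t - M|.+1)//; last by lia.
rewrite big_ord_recl big1 => [|i _]; last by rewrite /= mul0r.
change (1 * a (t - (0 + 0)) + 0 = a t).
by rewrite mul1r !addr0 ?subr0.
Qed.

Lemma lone_neq0 : lone != 0.
Proof.
apply/eqP => /(congr1 (fun a : laurent => a 0)) /= /eqP.
by rewrite oner_eq0.
Qed.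

HB.instance Definition _ := GRing.Zmodule_isComNzRing.Build laurent
  lmulA lmulC lmul1 lmulDl lone_neq0.

(** ** Valuation *)

Definition is_val (a : laurent) (i : int) : Prop :=
  a i != 0 /\ vanish_below i a.

Definition lval (a : laurent) : \bar int :=
  xget +oo%E [set i%:E | i in is_val a].

Lemma is_val_uniq a i j : is_val a i -> is_val a j -> i = j.
Proof.
move=> [ai vi] [aj vj]; have [ij|ji|//] := ltgtP i j.
  by move: ai; rewrite vj ?eqxx.
by move: aj; rewrite vi ?eqxx.
Qed.

Lemma is_val_ex a : a != 0 -> exists i, is_val a i.
Proof.
move=> a0; have [M aM] := lcoef_bound a.
have ex : exists n : nat, a (M + n%:Z) != 0.
  apply/not_existsP => h; move/eqP: a0; apply; apply: laurentP => t /=.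
  have [/aM//|Mt] := ltP t M.
  have -> : t = M + `|t - M|%N%:Z by lia.
  by apply/eqP/negPn/negP/h.
exists (M + (ex_minn ex)%:Z); case: ex_minnP => n an nmin; split=> // t tn.
have [/aM//|Mt] := ltP t M.
have e : t = M + `|t - M|%N%:Z by lia.
apply/eqP/negPn/negP => at0.
have : (n <= `|t - M|)%N by apply: nmin; rewrite -e.
lia.
Qed.

Lemma lval_fin a i : is_val a i -> lval a = i%:E.
Proof.
move=> ai; rewrite /lval; case: xgetP => [x _ [j aj <-]|/(_ i%:E)].
  by rewrite (is_val_uniq ai aj).
by case; exists i.
Qed.

Lemma lval0 : lval 0 = +oo%E.
Proof.
by rewrite /lval; case: xgetP => // x _ [j [/eqP]].
Qed.

(** ** Inverse *)

Definition linv (a : laurent) : laurent := xget 0 [set b | b * a = 1].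

(* The coefficients of 1 / (u_0 + u_1 X + ...), by the usual recursion. *)
Fixpoint inv_coefs (u : nat -> F) (n : nat) : seq F :=
  if n is n'.+1 then
    let s := inv_coefs u n' in
    rcons s ((u 0)^-1 * ((n' == 0)%:R - \sum_(i < n') s`_i * u (n' - i)%N))
  else [::].

Lemma size_inv_coefs u n : size (inv_coefs u n) = n.
Proof. by elim: n => //= n IH; rewrite size_rcons IH. Qed.

Lemma nth_inv_coefs u n k : (k < n)%N ->
  (inv_coefs u n)`_k = (inv_coefs u k.+1)`_k.
Proof.
elim: n => // n IH; rewrite ltnS leq_eqVlt => /orP[/eqP->//|kn].
by rewrite -IH//= nth_rcons size_inv_coefs kn.
Qed.

Lemma inv_coefsP u n : u 0 != 0 ->
  \sum_(i < n.+1) (inv_coefs u i.+1)`_i * u (n - i)%N = (n == 0)%:R.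
Proof.
move=> u0; rewrite big_ord_recr /= nth_rcons size_inv_coefs ltnn eqxx subnn.
rewrite mulrAC mulVf// mul1r.
under [X in X + _]eq_bigr => i _ do
  rewrite -[rcons _ _]/(inv_coefs u i.+1) -(nth_inv_coefs u (ltn_ord i)).
by rewrite addrC subrK.
Qed.

Lemma laurent_has_inv (a : laurent) : a != 0 -> exists b : laurent, b * a = 1.
Proof.
move=> /is_val_ex[M [aM0 aM]].
pose u (n : nat) : F := a (M + n%:Z).
have u0 : u 0 != 0 by rewrite /u addr0.
pose b0 (t : int) : F :=
  if t < - M then 0 else (inv_coefs u `|(t + M)%R|.+1)`_(`|(t + M)%R|%N).
have b0M : vanish_below (- M) b0 by move=> t; rewrite /b0 => ->.
have b0P : b0 \in laurent_pred by apply/asboolP; exists (- M).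
exists (Laurent b0P); apply: laurentP => t.
change (cauchy b0 a t = (t == 0)%:R).
have [t0|t0] := ltP t 0.
  by rewrite (vanish_below_cauchy b0M aM) ?addNr// lt_eqF.
rewrite (@cauchyE _ _ `|t|.+1 _ _ _ b0M aM); last by lia.
have -> : (t == 0) = (`|t|%N == 0%N) by lia.
rewrite -(inv_coefsP _ u0); apply: eq_bigr => i _.
have ilt := ltn_ord i.
rewrite /b0 ifF; last by lia.
have -> : `|(- M + i%:Z + M)%R|%N = i by lia.
by congr (_ * a _); lia.
Qed.

Lemma lmulVf (a : laurent) : a != 0 -> linv a * a = 1.
Proof.
move=> /laurent_has_inv[b ba]; rewrite /linv.
by case: xgetP => [x _ //|/(_ b)].
Qed.

Lemma linv0 : linv 0 = 0.
Proof.
rewrite /linv; case: xgetP => // b _ /= /esym/eqP.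
by rewrite mulr0 oner_eq0.
Qed.

HB.instance Definition _ := GRing.ComNzRing_isField.Build laurent lmulVf linv0.

(** ** Polynomials as Laurent series, polynomial and fractional part *)

Lemma polyL_subproof (p : {poly F}) :
  (fun t : int => if t <= 0 then p`_(`|t|%N) else 0) \in laurent_pred.
Proof.
apply/asboolP; exists (- (size p)%:Z) => t tp; case: ifP => // t0.
by rewrite nth_default//; move: (size p) tp => n tp; lia.
Qed.

Definition polyL (p : {poly F}) : laurent := Laurent (polyL_subproof p).

(* Terms z^i with i > - v(a) vanish, hence the size bound, see [coef_lfloor]. *)
Definition lfloor (a : laurent) : {poly F} :=
  if lval a is n%:E then \poly_(i < `|n|.+1) a (- i%:Z) else 0.

Lemma coef_lfloor a (i : nat) : (lfloor a)`_i = a (- i%:Z).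
Proof.
rewrite /lfloor; have [->|/is_val_ex[n an]] := eqVneq a 0.
  by rewrite lval0 coef0.
rewrite (lval_fin an) coef_poly; case: ifP => // /negbT ni.
by case: an => _ ->//; lia.
Qed.

Definition lfrac (a : laurent) : laurent := a - polyL (lfloor a).

Lemma coef_lfrac a t : lfrac a t = if t <= 0 then 0 else a t.
Proof.
change (a t - (if t <= 0 then (lfloor a)`_(`|t|%N) else 0) =
  if t <= 0 then 0 else a t).
have [t0|t0] := boolP (t <= 0); last by rewrite subr0.
rewrite coef_lfloor; have -> : - `|t|%N%:Z = t by lia.
by rewrite subrr.
Qed.

End LaurentSeries.

Section MultiContinuedFraction.
Variables (F : fieldType) (m : nat).

(* The dimension is m.+1, and {1, ..., m.+1} is represented by 'I_m.+1. *)
Notation lvec := 'cV[laurent F]_m.+1.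
Notation pvec := 'cV[{poly F}]_m.+1.

Definition floorv (r : lvec) : pvec := map_mx (@lfloor F) r.
Definition fracv (r : lvec) : lvec := map_mx (@lfrac F) r.
Definition polyLv (a : pvec) : lvec := map_mx (@polyL F) a.

(** * The indexed valuation *)

Definition Iv_lt (x y : 'I_m.+1 * \bar int) : bool :=
  ((x.2 < y.2)%E) || ((x.2 == y.2) && (x.1 < y.1)%N).

Definition Iv_le (x y : 'I_m.+1 * \bar int) : bool := (x == y) || Iv_lt x y.

Definition vval (r : lvec) : \bar int :=
  \big[Order.min/+oo%E]_(i < m.+1) lval (r i 0).

(* [enum 'I_m.+1] is increasing, so this is the least index attaining the
   minimum; for r = 0 it is the first index. *)
Definition Iidx (r : lvec) : 'I_m.+1 :=
  head ord0 [seq i <- enum 'I_m.+1 | lval (r i 0) == vval r].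

Definition Iv (r : lvec) : 'I_m.+1 * \bar int := (Iidx r, vval r).

(** * Minimal polynomials and linear complexity *)

(* The sequence c_(j,t) is the coefficient of z^(-1-t) in r_j; the condition
   only depends on the coefficients of z^(-1), ..., z^(-n) of r. *)
Definition is_charpoly (r : lvec) (n : nat) (q : {poly F}) : Prop :=
  q != 0 /\
  Iv_lt (ord_max, (n%:Z)%:E)
    (Iv (r - (polyL q)^-1 *: polyLv (floorv (polyL q *: r)))).

Definition is_minpoly (r : lvec) (n : nat) (q : {poly F}) : Prop :=
  is_charpoly r n q /\
  forall p, is_charpoly r n p -> ((size q).-1 <= (size p).-1)%N.

Definition linear_complexity (n : nat) (r : lvec) : nat :=
  xget 0%N [set d | exists2 q, is_minpoly r n q & d = (size q).-1].

(** * The m-CF transform *)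

(* [h C k] and [a C k] are h_k and a_k for 1 <= k < omega (and a_0 = 0); the
   values at other indices are irrelevant. [omega C = None] means that the
   length is infinite. *)
Record mCF : Type :=
  MCF { omega : option nat; h : nat -> 'I_m.+1; a : nat -> pvec }.

Definition lt_omega (C : mCF) (k : nat) : bool :=
  if omega C is Some w then (k < w)%N else true.

Definition Delta (c : 'I_m.+1 -> int) : 'M[laurent F]_m.+1 :=
  diag_mx (\row_j polyL 'X ^ (- c j)).

Definition rho (hk : 'I_m.+1) (beta : lvec) : lvec :=
  \col_j (if j == hk then (beta hk 0)^-1 else beta j 0 / beta hk 0).

(* One step from (c_(k-1), beta_(k-1)) to (c_k, beta_k); thus Delta_(k-2) is
   [Delta c] and Delta_(k-1) is [Delta c']. *)
Definition mCF_step (c : 'I_m.+1 -> int) (beta : lvec)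
    (hk : 'I_m.+1) (eps ak : pvec) (c' : 'I_m.+1 -> int) (beta' : lvec) : Prop :=
  [/\ hk = Iidx (Delta c *m beta),
      forall j, (c' j)%:E =
        if j == hk then vval (Delta c *m beta) else (c j)%:E,
      Iv_le (Iv (Delta c' *m fracv (rho hk beta)))
            (Iv (Delta c' *m polyLv eps)),
      ak = floorv (rho hk beta) - eps &
      beta' = fracv (rho hk beta) + polyLv eps].

Definition mCF_run (r : lvec) (C : mCF) (c : nat -> 'I_m.+1 -> int)
    (beta : nat -> lvec) (eps : nat -> pvec) : Prop :=
  [/\ a C 0 = 0, forall j, c 0 j = 0, beta 0 = r,
      forall k, lt_omega C k.+1 -> beta k != 0 /\
        mCF_step (c k) (beta k) (h C k.+1) (eps k.+1) (a C k.+1)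
          (c k.+1) (beta k.+1) &
      forall w, omega C = Some w -> exists2 k, w = k.+1 & beta k = 0].

Definition mCF_outputs (r : lvec) : set mCF :=
  [set C | exists c beta eps, mCF_run r C c beta eps].

(** ** Convergents *)

Definition Emx (hk : 'I_m.+1) : 'M[{poly F}]_(m.+1 + 1) :=
  xcol (lshift 1 hk) (rshift m.+1 ord0) 1%:M.

Definition Amx (ak : pvec) : 'M[{poly F}]_(m.+1 + 1) := block_mx 1%:M ak 0 1%:M.

Fixpoint Bmx (C : mCF) (k : nat) : 'M[{poly F}]_(m.+1 + 1) :=
  if k is k'.+1 then Bmx C k' *m Emx (h C k) *m Amx (a C k) else 1%:M.

Definition q_ (C : mCF) (k : nat) : {poly F} :=
  Bmx C k (rshift m.+1 ord0) (rshift m.+1 ord0).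

Definition t_ (C : mCF) (k : nat) : nat := (size (a C k (h C k) 0)).-1.

Definition v_ (C : mCF) (k : nat) : nat :=
  (\sum_(1 <= i < k.+1 | h C i == h C k) t_ C i)%N.

Definition d_ (C : mCF) (k : nat) : nat := (\sum_(1 <= i < k.+1) t_ C i)%N.

(* n_k for 0 <= k <= omega, with n_0 = 1 and n_omega = oo. *)
Definition n_ (C : mCF) (k : nat) : \bar int :=
  if k is k'.+1 then
    if lt_omega C k then ((d_ C k' + v_ C k)%N%:Z)%:E else +oo%E
  else 1%:E.

End MultiContinuedFraction.

(* Main.v *)
(** Let N_j and e = p_k - q_k r be the residuals p - q r of the columns (p; q)
of the convergent matrix B_k, and Q_j the bottom entries of its first m columns.
The transform makes N_j a vector with Iv(N_j) = (j, c_{k,j}), so a combination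
sum_j N_j x_j is as large as its largest term (no cancellation), and the
continued fraction expansion gives e = - sum_j N_j beta_{k,j}.  Hence
v(e) = v(Delta_{k-1} beta_k) = n_{k+1} - d_k, so q_k is a characteristic
polynomial up to length n_{k+1} - 1.  Conversely B_k is unimodular, so any
candidate is (p; q) = B_k (x; y), with residual sum_j N_j (x_j - beta_{k,j} y).
If q is characteristic for some n >= n_k, every x_j - beta_{k,j} y is therefore
small; as deg Q_j <= n_k - c_{k,j}, the decomposition
q = sum_j Q_j (x_j - beta_{k,j} y) + (q_k + sum_j Q_j beta_{k,j}) y
is dominated by its last term, and deg q = d_k + deg y >= d_k. *)

Require Import Defs.
From HB Require Import structures.
From mathcomp Require Import all_boot all_order all_algebra.
From mathcomp Require Import boolp classical_sets constructive_ereal.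
From mathcomp Require Import fingroup perm zify ring.

Set Implicit Arguments.
Unset Strict Implicit.
Unset Printing Implicit Defensive.

Import Order.TTheory GRing.Theory Num.Theory.
Local Open Scope ring_scope.

(** * Valuation arithmetic on Laurent series, and polynomials as a subring *)

Section Valuation.
Variable F : fieldType.
Implicit Types (a b : laurent F) (p q : {poly F}) (i j M N : int).

Lemma vanish_below_le M N a : vanish_below M a -> N <= M -> vanish_below N a.
Proof. by move=> aM NM; apply: vanish_belowS aM. Qed.

Lemma vanish_belowD M a b :
  vanish_below M a -> vanish_below M b -> vanish_below M (a + b).
Proof.
by move=> aM bM t tM; change (a t + b t = 0); rewrite aM// bM// addr0.
Qed.

Lemma vanish_belowN M a : vanish_below M a -> vanish_below M (- a).
Proof. by move=> aM t tM; change (- a t = 0); rewrite aM// oppr0. Qed.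

Lemma vanish_belowM M N a b :
  vanish_below M a -> vanish_below N b -> vanish_below (M + N) (a * b).
Proof. exact: vanish_below_cauchy. Qed.

Lemma vanish_below_sum M (I : Type) (s : seq I) (P : pred I)
    (f : I -> laurent F) :
  (forall x, P x -> vanish_below M (f x)) ->
  vanish_below M (\sum_(x <- s | P x) f x).
Proof.
move=> fM; apply: (big_ind (fun x : laurent F => vanish_below M x)) => //.
by move=> x y; apply: vanish_belowD.
Qed.

Lemma is_valM i j a b : is_val a i -> is_val b j -> is_val (a * b) (i + j).
Proof.
move=> [ai vi] [bj vj]; split; last exact: vanish_belowM.
change (cauchy a b (i + j) != 0).
(* At index [i + j] a single term of the Cauchy sum remains, the product of the two leading
   coefficients. *)
rewrite (@cauchyE _ i j 1%N _ _ _ vi vj); last by lia.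
rewrite big_ord_recl big_ord0 /=.
have -> : i + j - (i + 0) = j by lia.
by rewrite !addr0 mulf_neq0.
Qed.

Lemma is_valD i a b : is_val a i -> vanish_below (i + 1) b -> is_val (a + b) i.
Proof.
move=> [ai vi] bi; split; last first.
  by apply: vanish_belowD => //; apply: vanish_below_le bi _; lia.
by change (a i + b i != 0); rewrite bi ?addr0//; lia.
Qed.

Lemma is_valN i a : is_val a i -> is_val (- a) i.
Proof.
move=> [ai vi]; split; last exact: vanish_belowN.
by change (- a i != 0); rewrite oppr_eq0.
Qed.

Lemma is_val_le i M a : is_val a i -> vanish_below M a -> M <= i.
Proof.
move=> [ai _] aM; rewrite leNgt; apply/negP => /aM e.
by rewrite e eqxx in ai.
Qed.

Lemma is_val_neq0 i a : is_val a i -> a != 0.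
Proof. by move=> [ai _]; apply: contraNneq ai => ->. Qed.

Lemma is_val1 : is_val (1 : laurent F) 0.
Proof.
split=> [|t t0]; first exact: oner_neq0.
by change ((t == 0)%:R = 0 :> F); rewrite lt_eqF.
Qed.

Lemma is_valV i a : is_val a i -> is_val a^-1 (- i).
Proof.
move=> ai; have a0 := is_val_neq0 ai.
have [j bj] : exists j, is_val a^-1 j by apply: is_val_ex; rewrite invr_eq0.
have := is_valM ai bj; rewrite mulfV// => /(is_val_uniq is_val1) e.
by have <- : j = - i by lia.
Qed.

Lemma is_valXz i a (n : int) : is_val a i -> is_val (a ^ n) (i * n).
Proof.
have P k b j : is_val b j -> is_val (b ^+ k) (j * k%:Z).
  move=> bj; elim: k => [|k IH]; first by rewrite expr0 mulr0; exact: is_val1.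
  by rewrite exprS; have -> : j * k.+1%:Z = j + j * k%:Z; [lia|apply: is_valM].
move=> ai; case: n => n; first exact: P.
rewrite NegzE; have -> : i * - n.+1%:Z = - (i * n.+1%:Z) by lia.
by apply: is_valV; exact: P.
Qed.

Lemma lval_ge M a : (M%:E <= lval a)%E <-> vanish_below M a.
Proof.
have [->|/is_val_ex[i ai]] := eqVneq a 0; first by rewrite lval0 leey.
rewrite (lval_fin ai) lee_fin; split; last exact: is_val_le.
by case: ai => _ vi Mi; apply: vanish_below_le vi Mi.
Qed.

Lemma lval_eqy a : (lval a == +oo%E) = (a == 0).
Proof.
have [->|/is_val_ex[i ai]] := eqVneq a 0; first by rewrite lval0 eqxx.
by rewrite (lval_fin ai).
Qed.

Lemma polyL_is_zmod_morphism : zmod_morphism (@polyL F).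
Proof.
move=> p q; apply: laurentP => t.
change ((if t <= 0 then (p - q)`_(`|t|%N) else 0) =
  (if t <= 0 then p`_(`|t|%N) else 0) - (if t <= 0 then q`_(`|t|%N) else 0)).
by case: ifP => _; rewrite ?coefB ?subr0.
Qed.

Lemma vanish_below_polyL (s : nat) p :
  (size p <= s)%N -> vanish_below (1 - s%:Z) (polyL p).
Proof.
move=> ps t tp /=; case: ifP => // t0.
rewrite nth_default//; move: (size p) ps => n; lia.
Qed.

Lemma polyL_XM p : polyL ('X * p) = polyL 'X * polyL p.
Proof.
apply: laurentP => t.
have vX : vanish_below (- 1) (polyL 'X : laurent F).
  by have := @vanish_below_polyL 2 'X; rewrite size_polyX; apply.
have vp := vanish_below_polyL (leqnn (size p)).
set s := size p in vp.
change (polyL ('X * p) t = cauchy (polyL 'X) (polyL p) t).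
(* Any large enough count of terms would do: only the first one, at the single nonzero coefficient
   of ['X], survives. *)
rewrite (@cauchyE _ _ _ (`|t| + s).+2 _ _ _ vX vp); last by lia.
rewrite big_ord_recl big1 ?addr0 => [|i _]; last first.
  rewrite lift0 /= coefX; case: ifP => [h|_]; last by rewrite mul0r.
  by have -> : (`|(- 1 + i.+1%:Z)%R| == 1)%N = false; [lia|rewrite mul0r].
rewrite /= coefX /= mul1r coefXM.
have -> : t - -1 = t + 1 by lia.
case: (ltP t 0) => t0.
  have -> : t <= 0 by lia. have -> : t + 1 <= 0 by lia.
  have -> : (`|t| == 0)%N = false by lia.
  by congr (_ `_ _); lia.
have -> : (t + 1 <= 0) = false by lia.
by case: ifP => // t1; have -> : (`|t| == 0)%N by lia.
Qed.

Lemma polyL_CM (c : F) p : polyL (c%:P * p) = polyL c%:P * polyL p.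
Proof.
apply: laurentP => t.
have vc : vanish_below 0 (polyL c%:P : laurent F).
  have := @vanish_below_polyL 1 c%:P; rewrite subrr; apply.
  by rewrite size_polyC leq_b1.
have vp := vanish_below_polyL (leqnn (size p)).
set s := size p in vp.
change (polyL (c%:P * p) t = cauchy (polyL c%:P) (polyL p) t).
rewrite (@cauchyE _ _ _ (`|t| + s).+2 _ _ _ vc vp); last by lia.
rewrite big_ord_recl big1 ?addr0 => [|i _]; last first.
  by rewrite /= mul0r.
by rewrite /= coefC /= coefCM ?addr0 ?subr0; case: ifP; rewrite ?mulr0.
Qed.

HB.instance Definition _ := GRing.isZmodMorphism.Build {poly F} (laurent F)
  (@polyL F) polyL_is_zmod_morphism.

(** Horner induction on the left factor reduces multiplicativity to multiplication by a constant and
    by ['X], where the Cauchy sum has one term. *)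
Lemma polyL_is_monoid_morphism : monoid_morphism (@polyL F).
Proof.
have P1 : polyL (1 : {poly F}) = 1.
  apply: laurentP => t.
  change ((if t <= 0 then (1 : {poly F})`_(`|t|%N) else 0) = (t == 0)%:R).
  rewrite coef1; case: ifP => t0; first by congr (_ %:R); lia.
  by have -> : (t == 0) = false by lia.
split=> // p q; have PD : {morph @polyL F : x y / x + y} by exact: raddfD.
elim/poly_ind: p q => [|p c IH] q; first by rewrite mul0r raddf0 mul0r.
rewrite mulrDl !PD mulrDl polyL_CM -mulrA mulrCA polyL_XM !IH.
by rewrite mulrCA mulrA.
Qed.

HB.instance Definition _ := GRing.isMonoidMorphism.Build {poly F} (laurent F)
  (@polyL F) polyL_is_monoid_morphism.

Lemma is_val_polyL p : p != 0 -> is_val (polyL p) (- (size p).-1%:Z).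
Proof.
move=> p0; have := vanish_below_polyL (leqnn (size p)).
have : lead_coef p != 0 by rewrite lead_coef_eq0.
have : (0 < size p)%N by rewrite size_poly_gt0.
rewrite lead_coefE; case: (size p) => // s _ ps vp; split; last first.
  by apply: vanish_below_le vp _; lia.
rewrite /=; have -> : - s%:Z <= 0 by lia.
by rewrite abszN absz_nat.
Qed.

Lemma size_is_val_polyL p (d : nat) :
  is_val (polyL p) (- d%:Z) -> size p = d.+1.
Proof.
move=> pd; have p0 : p != 0.
  by have := is_val_neq0 pd; apply: contraNneq => ->; rewrite raddf0.
have := is_val_uniq pd (is_val_polyL p0); rewrite -size_poly_gt0 in p0.
by move: (size p) p0 => n; lia.
Qed.

Lemma lfloorD a : a = polyL (lfloor a) + lfrac a.
Proof. by rewrite /lfrac addrC subrK. Qed.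

Lemma vanish_below_lfrac M a : vanish_below M a -> vanish_below M (lfrac a).
Proof. by move=> aM t tM; rewrite coef_lfrac aM//; case: ifP. Qed.

Lemma lfrac_vanish a : vanish_below 1 (lfrac a).
Proof. by move=> t t1; rewrite coef_lfrac; case: ifP => //; lia. Qed.

(** Uniqueness of the splitting into a polynomial and a series of positive valuation. *)
Lemma lfrac_polyLD p a : vanish_below 1 a -> lfrac (polyL p + a) = a.
Proof.
move=> a1; apply: laurentP => t; rewrite coef_lfrac.
case: ifP => t0; first by rewrite a1//; lia.
change (polyL p t + a t = a t); by rewrite /= t0 add0r.
Qed.

End Valuation.

(** * Indexed valuations expressed through coefficientwise bounds *)

Section IndexedValuation.
Variables (F : fieldType) (m : nat).
Implicit Types (c : 'I_m.+1 -> int) (x y : 'cV[laurent F]_m.+1) (W v M : int).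

(* [Iv (Delta c *m x) >= (H, W)]; [H] may also be [m.+1]. *)
Definition Iv_ge c x (H : nat) W :=
  forall j : 'I_m.+1, vanish_below (W + (j < H)%N%:Z - c j) (x j 0).

(* [Iv (Delta c *m x) = (h, v)]. *)
Definition Iv_eq c x (h : 'I_m.+1) v :=
  is_val (x h 0) (v - c h) /\ Iv_ge c x h v.

Lemma Iv_ge_eq c x (H : nat) W h v :
  Iv_ge c x H W -> Iv_eq c x h v -> W + (h < H)%N%:Z <= v.
Proof. by move=> /(_ h) xW [xh _]; have := is_val_le xh xW; lia. Qed.

Lemma Iv_ge_le c x (H H' : nat) W W' :
    (forall j : 'I_m.+1, W' + (j < H')%N%:Z <= W + (j < H)%N%:Z) ->
  Iv_ge c x H W -> Iv_ge c x H' W'.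
Proof.
by move=> le xW j; apply: vanish_below_le (xW j) _; have := le j; lia.
Qed.

Lemma vval_ge x M : (M%:E <= vval x)%E <-> forall j, vanish_below M (x j 0).
Proof.
split=> [Mx j|xM].
  apply/lval_ge; apply: le_trans Mx _; exact: bigmin_le_cond.
by apply/bigmin_geP; split=> [|j _]; [rewrite leey|apply/lval_ge].
Qed.

Lemma vval0 : vval (0 : 'cV[laurent F]_m.+1) = +oo%E.
Proof. by apply: big1_idem => [|i _]; rewrite ?minxx// mxE lval0. Qed.

Lemma vval_attained x : exists j, lval (x j 0) = vval x.
Proof.
have [j _ e] := @eq_bigmin _ _ _ +oo%E ord0 xpredT
  (fun i => lval (x i 0)) isT (fun i _ => leey _).
by exists j; rewrite -e.
Qed.

Lemma IidxP x :
  lval (x (Iidx x) 0) = vval x /\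
  forall j : 'I_m.+1, (j < Iidx x)%N -> lval (x j 0) != vval x.
Proof.
set P := fun j : 'I_m.+1 => lval (x j 0) == vval x.
have hasP : has P (enum 'I_m.+1).
  have [j e] := vval_attained x.
  by apply/hasP; exists j; rewrite ?mem_enum// /P e.
(* The head of the filtered list is the entry at the first hit, so [nth_find] and [before_find]
   apply. *)
have E : Iidx x = nth ord0 (enum 'I_m.+1) (find P (enum 'I_m.+1)).
  rewrite /Iidx -/P; elim: (enum _) hasP => //= j s IH.
  by case: ifP.
have lt : (find P (enum 'I_m.+1) < m.+1)%N.
  by move: hasP; rewrite has_find size_enum_ord.
split; first by rewrite E; apply/eqP/(@nth_find _ ord0 P).
move=> j; rewrite E nth_enum_ord// => /(before_find ord0).
by rewrite nth_ord_enum => /negbT.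
Qed.

(** The entry at [Iidx x] is nonzero, since otherwise the minimum would be infinite. Entries of
    smaller index miss the minimum, and integrality makes their valuation larger by at least 1. *)
Lemma Iv_eqP x : x != 0 ->
  exists2 v, vval x = v%:E & Iv_eq (fun=> 0) x (Iidx x) v.
Proof.
move=> x0; have [xI xlt] := IidxP x.
have [xI0|/is_val_ex[v xv]] := eqVneq (x (Iidx x) 0) 0.
  case/eqP: x0; apply/colP => j; rewrite mxE; apply/eqP; rewrite -lval_eqy.
  by rewrite -leye_eq -(lval0 F) -xI0 xI; apply: bigmin_le_cond.
exists v; first by rewrite -xI (lval_fin xv).
rewrite (lval_fin xv) in xI.
split=> [|j]; rewrite subr0//; apply/lval_ge.
have : (v%:E <= lval (x j 0%R))%E by rewrite xI; apply: bigmin_le_cond.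
case: ltnP => [/xlt|]; last by rewrite addr0.
rewrite -xI; have [->|/is_val_ex[w xw]] := eqVneq (x j 0) 0.
  by rewrite lval0 !leey.
rewrite (lval_fin xw) !lee_fin => wv vw.
have : w != v by apply: contra_neq wv => ->.
lia.
Qed.

Lemma Delta_mulE c x j : (Delta F c *m x) j 0 = polyL 'X ^ (- c j) * x j 0.
Proof. by rewrite /Delta mul_diag_mx !mxE. Qed.

Lemma is_val_polyLXz (n : int) : is_val (polyL 'X ^ (- n) : laurent F) n.
Proof.
have X0 : 'X != 0 :> {poly F} by rewrite -size_poly_eq0 size_polyX.
have := @is_valXz _ _ _ (- n) (is_val_polyL X0).
by rewrite size_polyX mulrNN mul1r.
Qed.

Lemma is_val_Delta c x j v :
  is_val ((Delta F c *m x) j 0) v <-> is_val (x j 0) (v - c j).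
Proof.
rewrite Delta_mulE; have Xc := is_val_polyLXz (c j); split=> xv.
  have := is_valM (is_valV Xc) xv.
  by rewrite mulKf ?(is_val_neq0 Xc)// addrC.
by have := is_valM Xc xv; rewrite addrC subrK.
Qed.

Lemma vanish_below_Delta c x j M :
  vanish_below M ((Delta F c *m x) j 0) <-> vanish_below (M - c j) (x j 0).
Proof.
rewrite Delta_mulE; have Xc := is_val_polyLXz (c j); split=> xv.
  have := vanish_belowM (proj2 (is_valV Xc)) xv.
  by rewrite mulKf ?(is_val_neq0 Xc)// addrC.
by have := vanish_belowM (proj2 Xc) xv; rewrite addrC subrK.
Qed.

Lemma Iv_ge_Delta c x (H : nat) W :
  Iv_ge (fun=> 0) (Delta F c *m x) H W <-> Iv_ge c x H W.
Proof.
split=> xW j; have := xW j; rewrite subr0; first by move/vanish_below_Delta.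
by move=> ?; apply/vanish_below_Delta.
Qed.

Lemma Delta_mul_eq0 c x : (Delta F c *m x == 0) = (x == 0).
Proof.
apply/eqP/eqP => [x0|->]; last by rewrite mulmx0.
apply/colP => j; rewrite mxE; apply/eqP.
have /eqP : (Delta F c *m x) j 0 = 0 by rewrite x0 mxE.
by rewrite Delta_mulE mulf_eq0 (negPf (is_val_neq0 (is_val_polyLXz _))).
Qed.

Lemma Iv_eq_Delta c x : x != 0 ->
  exists2 v, vval (Delta F c *m x) = v%:E & Iv_eq c x (Iidx (Delta F c *m x)) v.
Proof.
rewrite -(Delta_mul_eq0 c) => /Iv_eqP[v e [xh xge]]; exists v => //.
split; last exact/Iv_ge_Delta.
by apply/is_val_Delta; rewrite -[v]subr0.
Qed.

(** The constraint on the free choice of [eps] enters the proof through this transfer of lower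
    bounds. *)
Lemma Iv_le_ge x y (H : nat) W : Iv_le (Iv x) (Iv y) ->
  Iv_ge (fun=> 0) x H W -> Iv_ge (fun=> 0) y H W.
Proof.
have [->|/Iv_eqP[w vy yw]] := eqVneq y 0; first by move=> _ _ j; rewrite mxE.
have [->|/Iv_eqP[v vx xv]] := eqVneq x 0.
  by rewrite /Iv_le /Iv_lt /Iv vval0 vy /= => /orP[/eqP[]|].
move=> le /Iv_ge_eq/(_ xv) Wv; apply: Iv_ge_le (proj2 yw) => j.
have : v < w \/ v = w /\ (Iidx x <= Iidx y)%N.
  move: le; rewrite /Iv_le /Iv_lt /Iv vx vy /=.
  case/orP=> [/eqP[-> <-]|]; first by right.
  rewrite lte_fin; case/orP=> [|/andP[/eqP[->] /ltnW]]; first by left.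
  by right.
lia.
Qed.

(** No index exceeds [ord_max], so a tie in the valuation is impossible and the strict comparison
    costs a full unit. *)
Lemma Iv_ltP x (n : int) :
  Iv_lt (ord_max, n%:E) (Iv x) <-> forall j, vanish_below (n + 1) (x j 0).
Proof.
rewrite -vval_ge /Iv_lt /Iv /= ltnNge -ltnS ltn_ord andbF orbF.
have [->|/Iv_eqP[v -> _]] := eqVneq x 0; first by rewrite vval0 ltry leey.
by rewrite lte_fin lee_fin; split; lia.
Qed.

End IndexedValuation.

(** * One step of the transform *)

Section Step.
Variables (F : fieldType) (m : nat).
Implicit Types (c : 'I_m.+1 -> int) (h : 'I_m.+1) (beta : 'cV[laurent F]_m.+1).

(** Here [v - c h] is the valuation of the leading entry [beta h]. Its positivity makes the exponent
    [c h] grow at the next step, by the degree of the partial quotient entry. *)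
Definition admissible c beta :=
  forall h v, Iv_eq c beta h v -> c h + 1 <= v.

(** Suppose the leading entry of the sum had nonpositive valuation. Taking fractional parts recovers
    [f] and loses no bound, so [f] starts strictly after [(h, v)]; by hypothesis so does [e], hence
    so does the sum, a contradiction. *)
Lemma admissible_frac c (f : 'cV[laurent F]_m.+1) (e : 'cV[{poly F}]_m.+1) :
    (forall j, vanish_below 1 (f j 0)) ->
    (forall (H : nat) W, Iv_ge c f H W -> Iv_ge c (polyLv e) H W) ->
  admissible c (f + polyLv e).
Proof.
move=> f1 fe h v [bh bge]; rewrite leNgt; apply/negP => vh.
have fge : Iv_ge c f h v.
  move=> j; have := bge j; rewrite !mxE addrC => /vanish_below_lfrac.
  by rewrite lfrac_polyLD.
(* If v <= c h then f h, being fractional, does not attain (h, v). *)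
have /fe eS : Iv_ge c f h.+1 v.
  move=> j; have [->|jh] := eqVneq j h.
    by apply: vanish_below_le (f1 h) _; lia.
  by apply: vanish_below_le (fge j) _; have : (j : nat) != h by []; lia.
have /is_val_le : vanish_below (v + 1 - c h) ((f + polyLv e) h 0).
  rewrite mxE; apply: vanish_belowD; last by have := eS h; rewrite ltnSn.
  by apply: vanish_below_le (f1 h) _; lia.
by move=> /(_ _ bh); lia.
Qed.

Lemma mCF_stepP c beta h eps ak c' beta' :
    beta != 0 -> admissible c beta -> mCF_step c beta h eps ak c' beta' ->
  exists v, [/\ Iv_eq c beta h v,
    forall j, c' j = if j == h then v else c j,
    rho h beta = polyLv ak + beta',
    Iv_ge c' beta' h.+1 (c h) & admissible c' beta'].
Proof.
move=> b0 adm [hE cE le -> ->]; have [v vE] := Iv_eq_Delta c b0.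
rewrite -hE => bv; exists v.
have c'E j : c' j = if j == h then v else c j.
  by have := cE j; rewrite vE; case: ifP => _ [].
have fe H W : Iv_ge c' (fracv (rho h beta)) H W -> Iv_ge c' (polyLv eps) H W.
  by move=> /Iv_ge_Delta/(Iv_le_ge le)/Iv_ge_Delta.
have f1 j : vanish_below 1 (fracv (rho h beta) j 0).
  by rewrite mxE; exact: lfrac_vanish.
have ch := adm _ _ bv; have [bh bge] := bv.
have fge : Iv_ge c' (fracv (rho h beta)) h.+1 (c h).
  move=> j; rewrite c'E; have [->|jh] := eqVneq j h.
    by apply: vanish_below_le (f1 h) _; lia.
  rewrite !mxE (negPf jh); apply: vanish_below_lfrac.
  apply: vanish_below_le (vanish_belowM (bge j) (proj2 (is_valV bh))) _.
  by have : (j : nat) != h by []; lia.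
split=> //; last exact: admissible_frac.
  apply/colP => j; rewrite !mxE [LHS]lfloorD raddfB /=; ring.
by move=> j; rewrite mxE; apply: vanish_belowD; [exact: fge|exact: fe].
Qed.

End Step.

(** * The invariant linking residuals, denominators and remainders *)

Section Invariant.
Variables (F : fieldType) (m : nat).
Implicit Types (c : 'I_m.+1 -> int) (h : 'I_m.+1).
Implicit Types (x beta e : 'cV[laurent F]_m.+1) (N : 'M[laurent F]_m.+1).
Implicit Types (Q : 'rV[laurent F]_m.+1) (q : 'M[laurent F]_1).

Definition Iv_reduced c N := forall j, Iv_eq (fun=> 0) (col j N) j (c j).

(* The leading positions of the columns of [N] are pairwise distinct, so no
   cancellation occurs in [N *m x]. *)
Lemma Iv_eq_mulmx c N x h v :
  Iv_reduced c N -> Iv_eq c x h v -> Iv_eq (fun=> 0) (N *m x) h v.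
Proof.
move=> Nc [xh xge].
have vb (i j : 'I_m.+1) :
  vanish_below (v + (i < j)%N%:Z + (j < h)%N%:Z) (N i j * x j 0).
  have := (Nc j).2 i; rewrite mxE => Nij.
  by apply: vanish_below_le (vanish_belowM Nij (xge j)) _; lia.
split=> [|i]; rewrite mxE subr0.
  rewrite (bigD1 h)//=; apply: is_valD.
    have := (Nc h).1; rewrite mxE subr0 => Nh.
    by have := is_valM Nh xh; rewrite addrC subrK.
  apply: vanish_below_sum => j jh; apply: vanish_below_le (vb h j) _.
  by have : (j : nat) != h by []; lia.
by apply: vanish_below_sum => j _; apply: vanish_below_le (vb i j) _; lia.
Qed.

(** Without cancellation the product starts at the leading position of [Delta c *m x], so a small
    product forces small coordinates. *)
Lemma Iv_reduced_vanish c N x (M : int) : Iv_reduced c N ->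
    (forall i, vanish_below M ((N *m x) i 0)) ->
  forall j, vanish_below (M - c j) (x j 0).
Proof.
move=> Nc NxM j; have [->|/(Iv_eq_Delta c)[v _ xv]] := eqVneq x 0.
  by rewrite mxE.
have := Iv_eq_mulmx Nc xv; set h := Iidx _ => -[Nxh _].
by apply: vanish_below_le (xv.2 j) _; have := is_val_le Nxh (NxM h); lia.
Qed.

(* The columns of [N] and [e] are the residuals p - q r of the columns (p; q)
   of the k-th convergent matrix, [Q] and [q] form its bottom row, d = d_k, and
   d + W = n_k. *)
Record invariant c beta N e Q q (d : int) (H : nat) (W : int) : Prop :=
  Invariant {
    inv_adm : admissible c beta;
    inv_ge : Iv_ge c beta H W;
    inv_red : Iv_reduced c N;
    inv_ker : e = - (N *m beta);
    inv_deg : is_val (q 0 0) (- d);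
    inv_bot : forall j : 'I_m.+1,
      vanish_below (c j + (H <= j)%N%:Z - d - W) (Q 0 j) }.

(** Since [e] is minus [N *m beta], it has leading position [(h, v)]; substituting it for column [h]
    therefore keeps the matrix reduced for the updated exponents. *)
Lemma invariant_step c beta N e Q q d H W c' beta' N' e' Q' q' a h v :
    invariant c beta N e Q q d H W ->
    Iv_eq c beta h v -> (forall j, c' j = if j == h then v else c j) ->
    rho h beta = a + beta' -> Iv_ge c' beta' h.+1 (c h) ->
    admissible c' beta' ->
    (forall i j, N' i j = if j == h then e i 0 else N i j) ->
    e' = col h N + N' *m a ->
    (forall j, Q' 0 j = if j == h then q 0 0 else Q 0 j) ->
    q' = col h Q + Q' *m a ->
  is_val (a h 0) (- (v - c h)) /\
  invariant c' beta' N' e' Q' q' (d + (v - c h)) h.+1 (c h).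
Proof.
move=> [adm ge red ker deg bot] bv c'E rhoE ge' adm' N'E e'E Q'E q'E.
have ch := adm _ _ bv; have Wv := Iv_ge_eq ge bv; have [bh bge] := bv.
have bh0 := is_val_neq0 bh.
have aE j : a j 0 = rho h beta j 0 - beta' j 0 by rewrite rhoE mxE addrK.
(* The leading term is that of the inverse of [beta h]; [beta'] starts at least one place later. *)
have ah : is_val (a h 0) (- (v - c h)).
  rewrite aE mxE eqxx; apply: is_valD; first exact: is_valV.
  by apply/vanish_belowN/(vanish_below_le (ge' h)); rewrite c'E eqxx; lia.
have aj (j : 'I_m.+1) :
  j != h -> vanish_below (c h + (j < h)%N%:Z - c j) (a j 0).
  move=> jh; have jh' : (j : nat) != h by [].
  rewrite aE mxE (negPf jh); apply: vanish_belowD.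
    have := vanish_belowM (bge j) (proj2 (is_valV bh)).
    by move=> /vanish_below_le; apply; lia.
  apply/vanish_belowN/(vanish_below_le (ge' j)); rewrite c'E (negPf jh); lia.
split=> //; split=> //.
- move=> j; rewrite c'E; have [->|jh] := eqVneq j h.
    have [Nh Nge] := Iv_eq_mulmx red bv.
    by split=> [|i]; rewrite mxE N'E eqxx ker mxE;
      [apply: is_valN|apply: vanish_belowN].
  have [Nj Nge] := red j.
  split=> [|i]; rewrite mxE N'E (negPf jh); first by rewrite mxE in Nj.
  by have := Nge i; rewrite mxE.
(* Dividing [e = - (N *m beta)] by [beta h] gives [col h N + N' *m rho h beta = 0], so only
   [- (N' *m beta')] remains. *)
- have aE' : a = rho h beta - beta' by rewrite rhoE addrK.
  rewrite e'E aE' mulmxBr addrA -[RHS]add0r; congr (_ - _).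
  apply/colP => i; rewrite !mxE.
  have /(congr1 (fun z : 'cV[laurent F]_m.+1 => z i 0)) := ker.
  rewrite !mxE (bigD1 h)//= => ei.
  rewrite (bigD1 h)//= N'E eqxx ei !mxE eqxx.
  rewrite [X in _ + (_ + X)](eq_bigr (fun j => N i j * beta j 0 / beta h 0)).
    by rewrite -mulr_suml; field.
  by move=> j jh; rewrite N'E mxE (negPf jh) mulrA.
(* The product [q * a h] dominates. For the term [Q h], either [h < H] and [Wv] is strict by one
   unit, or [H <= h] and [inv_bot] supplies that unit; the other terms are settled by the same
   tie-breaking. *)
- rewrite q'E !mxE (bigD1 h)//= Q'E eqxx addrCA.
  have := is_valM deg ah; rewrite -opprD => qa.
  apply: is_valD => //; apply: vanish_belowD.
    by apply: vanish_below_le (bot h) _; lia.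
  apply: vanish_below_sum => j jh; rewrite Q'E (negPf jh).
  apply: vanish_below_le (vanish_belowM (bot j) (aj j jh)) _.
  by have : (j : nat) != h by []; lia.
- move=> j; rewrite Q'E c'E; have [->|jh] := eqVneq j h.
    by apply: vanish_below_le (proj2 deg) _; lia.
  by apply: vanish_below_le (bot j) _; have : (j : nat) != h by []; lia.
Qed.

(** Here [delta] is the degree of a candidate with coordinates [(x; y)], and the conclusion reads
    deg y = delta - d. *)
Lemma invariant_degree c beta N e Q q d H W x y (delta n : int) :
    invariant c beta N e Q q d H W -> d + W <= n ->
    (forall i, vanish_below (n + 1 - delta) ((N *m x + y *: e) i 0)) ->
    is_val ((Q *m x) 0 0 + q 0 0 * y) (- delta) ->
  is_val y (d - delta).
Proof.
move=> [adm ge red ker deg bot] dn small qd.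
have Xs j : vanish_below (n + 1 - delta - c j) ((x - y *: beta) j 0).
  apply: (Iv_reduced_vanish red) => i; have := small i.
  by rewrite ker mulmxBr scalerN scalemxAr.
(* The indicators [H <= j] and [j < H] in [inv_bot] and [inv_ge] add up to 1, so each correction
   term lies strictly beyond [- d]. *)
have qQ : is_val (q 0 0 + (Q *m beta) 0 0) (- d).
  apply: is_valD => //; rewrite mxE; apply: vanish_below_sum => j _.
  by apply: vanish_below_le (vanish_belowM (bot j) (ge j)) _; lia.
have yE : is_val ((q 0 0 + (Q *m beta) 0 0) * y) (- delta).
  have -> : (q 0 0 + (Q *m beta) 0 0) * y =
      (Q *m x) 0 0 + q 0 0 * y + - (Q *m (x - y *: beta)) 0 0.
    have -> : (Q *m (x - y *: beta)) 0 0 = (Q *m x) 0 0 - y * (Q *m beta) 0 0.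
      by rewrite mulmxBr -scalemxAr [LHS]mxE [X in _ + X]mxE [X in _ - X]mxE.
    ring.
  (* The inequality [d + W <= n] puts every subtracted term at valuation at least [1 - delta]. *)
  apply: is_valD => //; rewrite mxE.
  apply/vanish_belowN/vanish_below_sum => j _.
  by apply: vanish_below_le (vanish_belowM (bot j) (Xs j)) _; lia.
by have := is_valM (is_valV qQ) yE; rewrite mulKf ?(is_val_neq0 qQ)// opprK.
Qed.

End Invariant.

(** * Convergent matrices and characteristic polynomials *)

Section Convergents.
Variables (F : fieldType) (m : nat) (C : mCF F m).
Implicit Types (r : 'cV[laurent F]_m.+1).

Let last_col : 'I_(m.+1 + 1) := rshift m.+1 ord0.

Section LeftMultiple.
Variables (n : nat) (W : 'M[laurent F]_(n, m.+1 + 1)).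

(** The column operations building B_k commute with left multiplication by a fixed [W], so residuals
    and bottom rows share one recurrence. *)
Definition convergent k := W *m map_mx (@polyL F) (Bmx C k).

Lemma convergentS k :
  (forall i j, lsubmx (convergent k.+1) i j =
     if j == h C k.+1 then rsubmx (convergent k) i 0
     else lsubmx (convergent k) i j) /\
  rsubmx (convergent k.+1) = col (h C k.+1) (lsubmx (convergent k)) +
     lsubmx (convergent k.+1) *m polyLv (a C k.+1).
Proof.
set hk := h C k.+1; set Z := xcol (lshift 1 hk) last_col (convergent k).
have Zl i j : lsubmx Z i j =
    if j == hk then rsubmx (convergent k) i 0 else lsubmx (convergent k) i j.
  rewrite !mxE; case: tpermP => [/lshift_inj->|/eqP|]; first by rewrite eqxx.
    by rewrite eq_lrshift.
  by case: eqP => [->|].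
have Zr : rsubmx Z = col hk (lsubmx (convergent k)).
  by apply/colP => i; rewrite !mxE tpermR.
have -> : convergent k.+1 =
    row_mx (lsubmx Z) (col hk (lsubmx (convergent k)) +
                       lsubmx Z *m polyLv (a C k.+1)).
  rewrite /convergent [Bmx C k.+1]/= !map_mxM !mulmxA -/(convergent k).
  rewrite /Emx map_xcol map_mx1 xcolE mul1mx -xcolE -/last_col -/Z.
  rewrite /Amx map_block_mx !map_mx1 map_mx0 -[Z in Z *m _]hsubmxK.
  by rewrite mul_row_block !mulmx1 mulmx0 addr0 Zr addrC.
by rewrite row_mxKl row_mxKr.
Qed.

Lemma convergent_mul k (w : 'M[{poly F}]_(m.+1 + 1, 1)) i :
  (W *m map_mx (@polyL F) (Bmx C k *m w)) i 0 =
  (lsubmx (convergent k) *m polyLv (usubmx w)) i 0 +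
  rsubmx (convergent k) i 0 * polyL (dsubmx w 0 0).
Proof.
rewrite map_mxM mulmxA -/(convergent k) -[convergent k in LHS]hsubmxK.
rewrite -[w in LHS]vsubmxK map_col_mx mul_row_col mxE; congr (_ + _).
by rewrite mxE big_ord1 [X in _ * X]mxE.
Qed.

End LeftMultiple.

(** Gives every candidate column polynomial coordinates with respect to B_k. The exchange is a
    permutation matrix, and negating [a] inverts the other factor. *)
Lemma Bmx_unit k : Bmx C k \in unitmx.
Proof.
elim: k => [|k IH] /=; first exact: unitmx1.
rewrite !unitmx_mul IH /Emx xcolE mul1mx unitmx_perm /=.
have [] := @mulmx1_unit _ _ (Amx (a C k.+1)) (Amx (- a C k.+1)) => //.
rewrite /Amx mulmx_block !mulmx1 !mul1mx !mul0mx mulmx0 !addr0 add0r addNr.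
by rewrite -scalar_mx_block.
Qed.

(** Maps a column (p; q) to p - q r. *)
Definition residual_form r : 'M[laurent F]_(m.+1, m.+1 + 1) :=
  row_mx 1%:M (- r).
Definition bottom_form : 'M[laurent F]_(1, m.+1 + 1) := row_mx 0 1%:M.

Lemma lt_omegaW k : lt_omega C k.+1 -> lt_omega C k.
Proof. by rewrite /lt_omega; case: omega => // w /ltnW. Qed.

(** The exponent c_{k,j} accumulates the degrees t_i with h_i = j; in particular c_{k,h_k} = v_k,
    which ties the transform to n_k. *)
Lemma convergent_invariant r c beta eps k : (0%:E < vval r)%E ->
    mCF_run r C c beta eps -> lt_omega C k ->
  [/\ forall j, c k j = (\sum_(1 <= i < k.+1 | h C i == j) t_ C i)%N%:Z &
      exists H W, (n_ C k = ((d_ C k)%:Z + W)%:E) /\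
        invariant (c k) (beta k)
          (lsubmx (convergent (residual_form r) k))
          (rsubmx (convergent (residual_form r) k))
          (lsubmx (convergent bottom_form k))
          (rsubmx (convergent bottom_form k)) (d_ C k)%:Z H W].
Proof.
move=> r0 [a0 c0 b0 run _].
have r1 j : vanish_below 1 (r j 0).
  apply: (vval_ge r 1).1; rewrite -?[1]/(0 + 1).
  by case: (vval r) r0 => //= v; rewrite lte_fin lee_fin; lia.
elim: k => [_|k IH kw].
  split=> [j|]; first by rewrite c0 big_geq.
  (* The value 1 reflects v(r) > 0 and matches the convention n_0 = 1. *)
  exists 0%N, 1; split; first by rewrite /d_ big_geq.
  rewrite /d_ big_geq// b0 /convergent /= map_mx1 !mulmx1.
  rewrite /residual_form /bottom_form !row_mxKl !row_mxKr.
  split.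
  - by move=> hh v [/is_val_le/(_ (r1 hh))]; rewrite c0; lia.
  - by move=> j; rewrite c0; apply: vanish_below_le (r1 j) _; lia.
  - move=> j; rewrite c0; split=> [|i]; rewrite !mxE.
      by rewrite eqxx; exact: is_val1.
    have [ij|ij] := eqVneq i j; last by [].
    by apply: vanish_below_le (is_val1 F).2 _; rewrite ij; lia.
  - by rewrite mul1mx.
  - by rewrite mxE eqxx; exact: is_val1.
  - by move=> j; rewrite mxE.
have [cE [H [W [_ inv]]]] := IH (lt_omegaW kw).
have [bk0 step] := run _ kw.
have [v [bv c'E rhoE ge' adm']] := mCF_stepP bk0 (inv_adm inv) step.
have [Nl Nr] := convergentS (residual_form r) k.
have [Ql Qr] := convergentS bottom_form k.
have [av inv'] := invariant_step inv bv c'E rhoE ge' adm' Nl Nr (Ql 0) Qr.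
set hk := h C k.+1 in bv c'E av inv' *.
have vh : c k hk + 1 <= v by apply: (inv_adm inv).
have tE : v - c k hk = (t_ C k.+1)%:Z.
  have [t vt] : exists t : nat, v - c k hk = t%:Z.
    by exists `|(v - c k hk)%R|%N; lia.
  by move: av; rewrite vt mxE => /size_is_val_polyL; rewrite /t_ -/hk => ->.
rewrite tE in inv'.
have dE : (d_ C k.+1)%:Z = (d_ C k)%:Z + (t_ C k.+1)%:Z.
  by rewrite /d_ [in LHS]big_nat_recr.
have cE' j : c k.+1 j = (\sum_(1 <= i < k.+2 | h C i == j) t_ C i)%N%:Z.
  rewrite c'E big_mkcond big_nat_recr//= -big_mkcond /= PoszD -cE eq_sym -/hk.
  by case: eqP => [<-|_]; rewrite ?addr0//; lia.
(* With d_k = d_{k-1} + t_k and v_k = c_{k-1,h_k} + t_k one gets n_k = d_k + c_{k-1,h_k}. *)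
split=> //; exists hk.+1, (c k hk); rewrite dE; split=> //.
rewrite /n_ kw; congr _%:E.
by rewrite PoszD /v_ -cE' c'E eqxx; lia.
Qed.

(** The approximation error is the fractional part of [q r] divided by [q], and this division adds
    deg q to valuations. *)
Lemma charpolyP r n (q : {poly F}) : q != 0 -> is_charpoly r n q <->
  forall j, vanish_below (n%:Z + 1 - (size q).-1%:Z) (lfrac (polyL q * r j 0)).
Proof.
move=> q0; have qv := is_val_polyL q0; have Lq0 := is_val_neq0 qv.
have E j : (r - (polyL q)^-1 *: polyLv (floorv (polyL q *: r))) j 0 =
    (polyL q)^-1 * lfrac (polyL q * r j 0).
  by rewrite !mxE /lfrac; field.
split=> [[_ /Iv_ltP qr] j|qr].
  have := vanish_belowM qv.2 (qr j); rewrite E mulVKf//.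
  by move=> pv; apply: vanish_below_le pv _; lia.
split=> //; apply/Iv_ltP => j; rewrite E.
by apply: vanish_below_le (vanish_belowM (is_valV qv).2 (qr j)) _; lia.
Qed.

End Convergents.

Theorem corollary6p11 (F : fieldType) (m : nat) (r : 'cV[laurent F]_m.+1)
  (r_gt0 : (0%:E < vval r)%E) (C : mCF F m) (CT : mCF_outputs r C)
  (k : nat) (k_lt : lt_omega C k) (n : nat)
  (n_bounds : (n_ C k <= (n%:Z)%:E < n_ C k.+1)%E) :
  is_minpoly r n (q_ C k) /\ linear_complexity n r = d_ C k.
Proof.
have [c [beta [eps run]]] := CT.
have [cE [H [W [nE inv]]]] := convergent_invariant r_gt0 run k_lt.
have [_ _ _ steps stop] := run.
have /andP[nk nk1] := n_bounds.
rewrite nE lee_fin in nk.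
set N := lsubmx _ in inv; set e := rsubmx _ in inv.
set Q := lsubmx _ in inv; set q := rsubmx (convergent C _ k) in inv.
have qE : q 0 0 = polyL (q_ C k).
  rewrite /q /convergent /bottom_form -[map_mx _ _]vsubmxK mul_row_col.
  by rewrite mul0mx mul1mx add0r !mxE.
have qdeg : is_val (polyL (q_ C k)) (- (d_ C k)%:Z).
  by rewrite -qE; exact: inv_deg inv.
have qsize := size_is_val_polyL qdeg.
have q0 : q_ C k != 0 by rewrite -size_poly_eq0 qsize.
have c_ge0 j : 0 <= c k j by rewrite cE.
(* The first bound makes p_k the polynomial part of q_k r; the second is the approximation order. *)
have small j : vanish_below 1 (e j 0) /\
    vanish_below (n%:Z + 1 - (d_ C k)%:Z) (e j 0).
  have eE := inv_ker inv.
  (* If the transform has stopped, the residual is exactly zero, in accordance with n_omega being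
     infinite. *)
  have [b0|b0] := eqVneq (beta k) 0; first by rewrite eE b0 mulmx0 oppr0 mxE.
  have kw : lt_omega C k.+1.
    move: k_lt stop b0; rewrite /lt_omega; case: omega => // w.
    rewrite leq_eqVlt eq_sym => /orP[/eqP-> /(_ _ erefl)[_ [<-] ->]|//].
    by rewrite eqxx.
  have [cE' _] := convergent_invariant r_gt0 run kw.
  have [v [bv c'E _ _ _]] := mCF_stepP b0 (inv_adm inv) (steps _ kw).2.
  (* Here [v] is v_{k+1}: admissibility with nonnegative exponents gives [v >= 1], and n < n_{k+1} =
     d_k + v gives the other bound. *)
  have := inv_adm inv bv; have := c_ge0 (h C k.+1).
  move: nk1; rewrite /n_ kw lte_fin PoszD /v_ -cE' c'E eqxx => nv c0 cv.
  have := (Iv_eq_mulmx (inv_red inv) bv).2 j; rewrite subr0 => Nb.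
  by rewrite eE mxE; split; apply/vanish_belowN/(vanish_below_le Nb); lia.
have char_q : is_charpoly r n (q_ C k).
  apply/charpolyP => // j; rewrite qsize.
  have -> : polyL (q_ C k) * r j 0 =
      polyL (Bmx C k (lshift 1 j) (rshift m.+1 ord0)) + - e j 0.
    rewrite /e /convergent /residual_form -[map_mx _ _]vsubmxK mul_row_col.
    rewrite mul1mx mxE [(usubmx _ + _) _ _]mxE.
    rewrite [(- r *m _) _ _]mxE big_ord1 !mxE /q_; ring.
  rewrite lfrac_polyLD; last exact/vanish_belowN/(small j).1.
  exact/vanish_belowN/(small j).2.
have min_q p : is_charpoly r n p -> ((size (q_ C k)).-1 <= (size p).-1)%N.
  move=> char_p; have p0 := char_p.1; move/(charpolyP _ _ p0): char_p => pr.
  (* The candidate [p] is completed by the polynomial part of [p r], so that its residual is minus a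
     fractional part. *)
  set z : 'M[{poly F}]_(m.+1 + 1, 1) := col_mx (floorv (polyL p *: r)) p%:M.
  pose w := invmx (Bmx C k) *m z.
  have zE : z = Bmx C k *m w by rewrite mulKVmx// Bmx_unit.
  have Nw i : (N *m polyLv (usubmx w) + polyL (dsubmx w 0 0) *: e) i 0 =
      - lfrac (polyL p * r i 0).
    rewrite [LHS]mxE [X in _ + X]mxE mulrC -convergent_mul -zE.
    rewrite /residual_form /z map_col_mx mul_row_col mul1mx map_scalar_mx.
    rewrite mul_mx_scalar !mxE /lfrac; ring.
  have Qw : (Q *m polyLv (usubmx w)) 0 0 + q 0 0 * polyL (dsubmx w 0 0) =
      polyL p.
    rewrite -convergent_mul -zE /bottom_form /z map_col_mx mul_row_col.
    by rewrite mul0mx mul1mx add0r !mxE.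
  have yv : is_val (polyL (dsubmx w 0 0)) ((d_ C k)%:Z - (size p).-1%:Z).
    apply: (invariant_degree (x := polyLv (usubmx w)) inv nk).
      by move=> i; rewrite Nw; exact/vanish_belowN/pr.
    by rewrite Qw; exact: is_val_polyL.
  have y0 : dsubmx w 0 0 != 0.
    by have := is_val_neq0 yv; apply: contra_neq => ->; rewrite raddf0.
  (* The last coordinate is a nonzero polynomial, so its degree, deg p - d_k, is nonnegative. *)
  have := is_val_uniq yv (is_val_polyL y0); rewrite qsize; lia.
have min : is_minpoly r n (q_ C k) by [].
split=> //; rewrite /linear_complexity.
case: xgetP => [d _ [p [char_p min_p] ->]|].
  by have := min_q _ char_p; have := min_p _ char_q; rewrite qsize /=; lia.
by move/(_ (d_ C k)); case; exists (q_ C k) => //; rewrite qsize.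
Qed.
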